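(* For all integers $1\le l<d\le k-1$, it holds that $\beta_d(k)\le\beta_{d-l}(k-l)$.
   Context: A $k$-uniform hypergraph $G=(V,E)$ consists of a finite vertex set $V$ and a set $E$ of $k$-element subsets of $V$ (edges). For a $d$-subset $A$ of $V$, $\deg_d A$ is the number of edges containing $A$, and $\delta_d(G)$ is the minimum of $\deg_d A$ over all $d$-subsets $A$ of $V$. A fractional perfect matching of $G$ is a weight assignment $\mathbf{x}\in[0,1]^E$ such that $\sum_{e\ni v}\mathbf{x}_e=1$ for every $v\in V$. Its entropy is $h(\mathbf{x}):=-\sum_{e\in E}\mathbf{x}_e\ln\mathbf{x}_e$ (with $0\ln 0=0$), and the entropy of $G$ is $h(G):=\sup_{\mathbf{x}}h(\mathbf{x})$ over all fractional perfect matchings $\mathbf{x}$ of $G$ (with value $-\infty$ if there are none). For integers $1\le d\le k-1$, the $d$-degree $k$-uniform approximate counting threshold $\beta_d(k)$ is the minimum $\beta>0$ such that for all $\gamma,\epsilon>0$ there exists $n_0$ such that for all $n\ge n_0$ (no divisibility relation between $k$ and $n$ is assumed), if $G$ is a $k$-uniform $n$-vertex hypergraph with $\delta_d(G)\ge(\beta+\gamma)\binom{n-d}{k-d}$, then $h(G)\ge\frac{n}{k}\ln\left((1-\epsilon)\frac{k}{n}\frac{\binom{n}{d}}{\binom{k}{d}}\delta_d(G)\right)$. *)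

(* Defs.v *)
From HB Require Import structures.
From mathcomp Require Import all_boot all_order all_algebra.
From mathcomp Require Import boolp classical_sets reals ereal exp.

Set Implicit Arguments.
Unset Strict Implicit.
Unset Printing Implicit Defensive.

Import Order.TTheory GRing.Theory Num.Theory.

Local Open Scope classical_set_scope.
Local Open Scope ring_scope.

Section Hypergraph.
Variable V : finType.
Implicit Types (E : {set {set V}}) (A : {set V}).

Definition uniform (k : nat) E : Prop := forall e, e \in E -> #|e| = k.

Definition degree E A : nat := #|[set e in E | A \subset e]|.

(* Since degree E A <= #|E|, the unit #|E| does not affect the minimum when
   d-subsets exist; without d-subsets the value is #|E| by convention. *)
Definition min_degree (d : nat) E : nat :=
  \big[minn/#|E|]_(A : {set V} | #|A| == d) degree E A.

Variable R : realType.

(* Only the values of x on E matter. *)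
Definition fractional_perfect_matching E (x : {set V} -> R) : Prop :=
  (forall e, e \in E -> 0 <= x e <= 1) /\
  (forall v : V, \sum_(e in E | v \in e) x e = 1).

Definition weight_entropy E (x : {set V} -> R) : R :=
  - \sum_(e in E) x e * ln (x e).

(* ereal_sup set0 = -oo. *)
Definition hypergraph_entropy E : \bar R :=
  ereal_sup [set (weight_entropy E x)%:E | x in fractional_perfect_matching E].

End Hypergraph.

(* For eps >= 1 the argument of the logarithm is nonpositive, where
   mathcomp's total ln returns 0 instead of being undefined or -oo: hence the
   restriction eps < 1. *)
Definition approx_counting (R : realType) (d k : nat) (b : R) : Prop :=
  forall gamma eps : R, 0 < gamma -> 0 < eps -> eps < 1 ->
  exists n0 : nat, forall n : nat, (n0 <= n)%N ->
  forall (V : finType) (E : {set {set V}}), #|V| = n -> uniform k E ->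
    (b + gamma) * 'C(n - d, k - d)%:R <= (min_degree d E)%:R ->
    ((n%:R / k%:R *
      ln ((1 - eps) * (k%:R / n%:R) * ('C(n, d)%:R / 'C(k, d)%:R)
          * (min_degree d E)%:R))%:E
     <= hypergraph_entropy R E)%E.

Definition approx_counting_threshold (R : realType) (d k : nat) : R :=
  inf [set b : R | 0 < b /\ approx_counting d k b].

(* The infimum is the minimum: a minimum, if any, equals the threshold, and the
   infimum is attained as soon as it is positive. *)
Lemma approx_counting_threshold_eq (R : realType) (d k : nat) (b : R) :
  0 < b -> approx_counting d k b ->
  (forall b' : R, 0 < b' -> approx_counting d k b' -> b <= b') ->
  approx_counting_threshold R d k = b.
Proof.
move=> b0 bP bmin; apply/eqP; rewrite eq_le; apply/andP; split.
  by apply: ge_inf => //; exists 0 => y [/ltW].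
by apply: lb_le_inf; [exists b | move=> y [y0 yP]; exact: bmin].
Qed.

Lemma approx_counting_threshold_min (R : realType) (d k : nat)
    (b := approx_counting_threshold R d k) :
  0 < b -> approx_counting d k b /\
  (forall b' : R, 0 < b' -> approx_counting d k b' -> b <= b').
Proof.
move=> b0; have [hS|/inf_out S0] := pselect (has_inf
    [set b : R | 0 < b /\ approx_counting d k b]); last first.
  by move: b0; rewrite /b /approx_counting_threshold S0 ltxx.
split=> [gamma eps g0 e0 e1|b' b'0 b'P]; last by apply: ge_inf => //; case: hS.
have g20 : 0 < gamma / 2 by rewrite divr_gt0.
have [c [c0 cP] cb] := inf_adherent g20 hS.
have [n0 n0P] := cP _ _ g20 e0 e1; exists n0 => n nn0 V E cV uE dE.
apply: n0P => //; apply: le_trans dE; apply: ler_wpM2r => //.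
have -> : b + gamma = b + gamma / 2 + gamma / 2 by rewrite -addrA -splitr.
by rewrite lerD2r ltW.
Qed.

(* Main.v *)
Require Import Defs.
From mathcomp Require Import all_boot all_order all_algebra.
From mathcomp Require Import lra ring zify.
From mathcomp Require Import boolp reals ereal exp.

Set Implicit Arguments.
Unset Strict Implicit.
Unset Printing Implicit Defensive.

Import Order.TTheory GRing.Theory Num.Theory.

Local Open Scope ring_scope.

(** The links of a [k]-uniform hypergraph [E] on [n] vertices inherit its degree
    condition: for an [l]-set [L], the link of [L] is [(k - l)]-uniform on [n - l]
    vertices and its minimum [(d - l)]-degree is at least the minimum [d]-degree of
    [E] ([min_degree_link]), while the reference count [C(n - d, k - d)] is the
    same for both. So if [b] is admissible for [(d - l, k - l)], every link carries
    a fractional perfect matching [y L] of entropy at least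
    [(n - l) / (k - l) * ln v], where
    [v = (1 - eps) (k - l) / (n - l) C(n - l, d - l) / C(k - l, d - l) delta_d(E)].

    Giving an edge [e] a weight proportional to the sum of [y L (e \ L)] over the
    [l]-subsets [L] of [e] produces a fractional perfect matching of [E], since
    every vertex receives the same weight ([link_average_vertex]). Up to
    normalisation this is the law of the edge obtained by choosing [L] uniformly
    and then an edge of its link according to [y L]. Such a pair has entropy
    [ln C(n, l)] plus the average link entropy, and an edge of [E] comes from only
    [C(k, l)] choices of [L], so at most [ln C(k, l)] is lost by forgetting [L]
    ([log_sum], [link_average_entropy]). The identity
    [C(n, l) C(n - l, d - l) = C(n, d) C(d, l)], used for [n] and for [k], turns
    the resulting bound into exactly the one required of [E], with the same [eps]
    ([approx_counting_link]). Hence every [b] admissible for [(d - l, k - l)] is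
    admissible for [(d, k)]; as infima are compared, it remains that some [b] is
    admissible for [(d - l, k - l)], and [b = 1] is ([approx_counting1]). *)

(** * Binomial coefficients and the log-sum inequality *)

Lemma mul_bin_bin (n d l : nat) : (l <= d <= n)%N ->
  ('C(n, l) * 'C(n - l, d - l) = 'C(n, d) * 'C(d, l))%N.
Proof.
case/andP=> ld dn.
have P0 : (0 < l`! * ((d - l)`! * (n - d)`!))%N by rewrite !muln_gt0 !fact_gt0.
apply/eqP; rewrite -(eqn_pmul2r P0); apply/eqP.
have h1 := bin_fact (leq_trans ld dn); have h2 := bin_fact dn.
have h3 := bin_fact ld; have h4 : (d - l <= n - l)%N by rewrite leq_sub2r.
have := bin_fact h4; rewrite subnBA // subnK ?(leq_trans ld dn) // => h5.
rewrite -h5 in h1; rewrite -h3 in h2.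
transitivity (n`!)%N; first by rewrite -h1; ring.
by rewrite -h2; ring.
Qed.

(** Entropy is at most the logarithm of the size of the support. Stated for
    unnormalised weights; each term follows from [ln t <= t - 1] at
    [t = X / (M a_i)], where [X] is the total and [M] the number of weights. *)
Lemma log_sum (R : realType) (I : finType) (P : pred I) (a : I -> R) :
  (forall i, P i -> 0 <= a i) ->
  (\sum_(i | P i) a i) * ln (\sum_(i | P i) a i) <=
  \sum_(i | P i) a i * ln (a i) + (\sum_(i | P i) a i) * ln #|P|%:R.
Proof.
set X := \sum_(i | P i) a i => a0.
have X0 : 0 <= X by apply: sumr_ge0.
have termwise i : P i ->
    a i * ln X <= a i * ln (a i) + a i * ln #|P|%:R + (X / #|P|%:R - a i).
  move=> Pi; have M0 : 0 < #|P|%:R :> R by rewrite ltr0n; apply/card_gt0P; exists i.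
  have [->|ai_neq0] := eqVneq (a i) 0.
    by rewrite !mul0r !add0r subr0 divr_ge0 // ltW.
  have ai0 : 0 < a i by rewrite lt_neqAle eq_sym ai_neq0 a0.
  have aiX : a i <= X.
    by rewrite /X (bigD1 i) //= lerDl sumr_ge0 // => j /andP[Pj _]; exact: a0.
  have Xgt0 := lt_le_trans ai0 aiX.
  have q0 : 0 < X / #|P|%:R / a i by rewrite !divr_gt0.
  have := @le_ln1Dx R (X / #|P|%:R / a i - 1); rewrite [1 + _]addrC subrK.
  rewrite ltrBrDl subrr => /(_ q0).
  rewrite !ln_div ?posrE ?divr_gt0 // -(ler_pM2l ai0) => h.
  have -> : X / #|P|%:R - a i = a i * (X / #|P|%:R / a i - 1).
    by field; rewrite ai_neq0 lt0r_neq0.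
  by move: h; rewrite !mulrBr; lra.
rewrite [leLHS]mulr_suml; apply: le_trans (ler_sum _ termwise) _.
rewrite !big_split /= -mulr_suml -/X sumrN -/X gerDl sumr_const -mulrnAr.
have [M0|M_neq0] := eqVneq #|P| 0%N.
  by rewrite M0 mulr0n mulr0 sub0r oppr_le0.
by rewrite -[in leLHS](mulr_natr _ #|P|) mulVf ?mulr1 ?subrr // pnatr_eq0.
Qed.

(** * Degrees *)

Section Degrees.
Variables (V : finType) (E : {set {set V}}).
Implicit Types A : {set V}.

Lemma exists_set_card (d : nat) : (d <= #|V|)%N -> exists A : {set V}, #|A| = d.
Proof.
rewrite -bin_gt0 -cardsT -cards_draws => /card_gt0P[A].
by rewrite inE => /andP[_ /eqP]; exists A.
Qed.

Lemma min_degree_le A : (min_degree #|A| E <= degree E A)%N.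
Proof. by rewrite /min_degree -minEnat -leEnat; apply: bigmin_le_cond. Qed.

Lemma min_degree_ge (d m : nat) : (d <= #|V|)%N ->
  (forall A, #|A| = d -> (m <= degree E A)%N) -> (m <= min_degree d E)%N.
Proof.
move=> dV mA; rewrite /min_degree.
apply: (big_ind (fun x => m <= x)%N) => [|x y mx my|A /eqP]; last exact: mA.
  have [A Ad] := exists_set_card dV; apply: leq_trans (mA _ Ad) _.
  by apply: subset_leq_card; apply/fintype.subsetP => e; rewrite inE => /andP[].
by rewrite leq_min mx.
Qed.

Lemma degree_le_bin (k : nat) A : uniform k E ->
  (degree E A <= 'C(#|V| - #|A|, k - #|A|))%N.
Proof.
move=> uE; have <- : #|~: A| = (#|V| - #|A|)%N by rewrite cardsCs setCK.
rewrite -cards_draws /degree.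
have injD : {in [set e in E | A \subset e] &, injective (fun e => e :\: A)}.
  move=> e f; rewrite !inE => /andP[_ Ae] /andP[_ Af] /= ef.
  by rewrite -(setID e A) -(setID f A) ef !(setIidPr _).
rewrite -(card_in_imset injD); apply: subset_leq_card.
apply/fintype.subsetP => _ /imsetP[e eE ->]; move: eE; rewrite !inE => /andP[eE Ae].
by rewrite subsetDr cardsDS // uE ?eqxx.
Qed.

End Degrees.

(** * Links *)

Section Link.
Variables (V : finType) (L : {set V}).
Implicit Types (E : {set {set V}}) (e : {set V}).

(** The link of [L] lives on its own vertex type, so that the threshold property
    applies to it directly. *)
Definition outside : finType := {v : V | v \notin L}.

Definition trace e : {set outside} := [set v | val v \in e].

Definition link E : {set {set outside}} :=
  [set trace e | e in E & L \subset e].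

Lemma card_outside : #|outside| = (#|V| - #|L|)%N.
Proof.
rewrite card_sig -[L in RHS]setCK -cardsCs.
by apply: eq_card => v; rewrite !inE.
Qed.

Lemma card_trace e : L \subset e -> #|trace e| = (#|e| - #|L|)%N.
Proof.
move=> Le; rewrite -cardsDS // -(card_imset (trace e) val_inj).
apply: eq_card => v; rewrite inE; apply/imsetP/andP => [[u ue ->]|[vL ve]].
  by split; [exact: (valP u) | move: ue; rewrite inE].
by exists (exist _ v vL); rewrite ?inE.
Qed.

Lemma trace_inj E : {in [set e in E | L \subset e] &, injective trace}.
Proof.
move=> e f; rewrite !inE => /andP[_ Le] /andP[_ Lf] ef; apply/setP => v.
have [vL|vL] := boolP (v \in L).
  by rewrite (fintype.subsetP Le) ?(fintype.subsetP Lf).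
by have /setP/(_ (exist _ v vL)) := ef; rewrite !inE.
Qed.

Lemma uniform_link E (k : nat) : uniform k E -> uniform (k - #|L|) (link E).
Proof.
move=> uE _ /imsetP[e eE ->]; move: eE; rewrite inE => /andP[eE Le].
by rewrite card_trace // uE.
Qed.

Lemma degree_link E (A : {set outside}) :
  degree (link E) A = degree E (L :|: val @: A).
Proof.
rewrite /degree.
have injT : {in [set e in E | L :|: val @: A \subset e] &, injective trace}.
  by move=> e f; rewrite !inE !subUset => /and3P[eE Le _] /and3P[fE Lf _];
    apply: (@trace_inj E); rewrite inE ?eE ?fE.
rewrite -(card_in_imset injT); congr #|pred_of_set _|; apply/setP => f.
have sub e : (A \subset trace e) = (val @: A \subset e).
  apply/fintype.subsetP/fintype.subsetP => [h _ /imsetP[u uA ->]|h u uA].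
    by have := h u uA; rewrite inE.
  by rewrite inE h // imset_f.
rewrite inE; apply/andP/imsetP => [[/imsetP[e eE ->]]|[e eE ->]]; move: eE.
  rewrite !inE sub => /andP[eE Le] Ae.
  by exists e; rewrite // inE eE subUset Le.
rewrite !inE subUset sub => /and3P[eE Le ->]; split=> //.
by apply: imset_f; rewrite inE eE.
Qed.

(** Adding [L] to a set of vertices of the link turns its codegree in the link
    into a codegree in [E], so passing to the link cannot lower the minimum. *)
Lemma min_degree_link E (d : nat) : (#|L| <= d <= #|V|)%N ->
  (min_degree d E <= min_degree (d - #|L|) (link E))%N.
Proof.
case/andP=> Ld dV; apply: min_degree_ge => [|A Ad].
  by rewrite card_outside leq_sub2r.
rewrite degree_link; have <- : #|L :|: val @: A| = d; last exact: min_degree_le.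
rewrite cardsU (card_imset _ val_inj) Ad subnKC // disjoint_setI0 ?cards0 ?subn0 //.
rewrite disjoint_sym disjoint_subset; apply/fintype.subsetP => _ /imsetP[u _ ->].
exact: (valP u).
Qed.

(** An edge of the link comes from exactly one edge of [E] containing [L]; sums over
    a link thus become sums over [E], where different [L] can be compared. *)
Lemma sum_link (R : realType) E (F : {set outside} -> R) :
  \sum_(f in link E) F f = \sum_(e in E | L \subset e) F (trace e).
Proof.
rewrite (big_imset _ (@trace_inj E)).
by apply: eq_bigl => e; rewrite inE.
Qed.

End Link.

(** * Averaging fractional perfect matchings of links *)

(** Double counting of incident pairs of a vertex and an edge. *)
Lemma fractional_perfect_matching_total (R : realType) (V : finType)
    (E : {set {set V}}) (k : nat) (x : {set V} -> R) :
  uniform k E -> fractional_perfect_matching E x ->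
  k%:R * \sum_(e in E) x e = #|V|%:R.
Proof.
move=> uE [_ xV]; rewrite -sum1_card natr_sum mulr_sumr.
under [RHS]eq_bigr => v _ do rewrite -(xV v).
rewrite (exchange_big_dep (mem E)) /=; last by move=> v e _ /andP[].
apply: eq_bigr => e eE; rewrite mulr_natl -(uE e eE) -sumr_const.
by apply: eq_bigl => v; rewrite eE.
Qed.

Lemma card_draws_avoiding (V : finType) (v : V) (l : nat) :
  #|[set L : {set V} | (#|L| == l) && (v \notin L)]| = 'C(#|V|.-1, l).
Proof.
rewrite -(cardsC1 v) -cards_draws; apply: eq_card => L; rewrite !inE andbC.
congr (_ && _); apply/idP/fintype.subsetP => [vL u uL|h].
  by rewrite !inE; apply: contraNneq vL => <-.
by apply/negP => /h; rewrite !inE eqxx.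
Qed.

Section Average.
Variables (R : realType) (V : finType) (E : {set {set V}}) (k l : nat).
Hypotheses (uE : uniform k E) (lk : (l < k)%N) (lV : (l < #|V|)%N).
Variable y : forall L : {set V}, {set outside L} -> R.
Arguments y : clear implicits.
Hypothesis yP : forall L : {set V}, #|L| = l -> fractional_perfect_matching (link L E) (y L).

Local Notation n := #|V|.

(** Each of the [C(n, l)] links has total weight [(n - l) / (k - l)], while a
    fractional perfect matching of [E] has total weight [n / k]: this is the ratio
    of [n / k] to the sum of the former. *)
Definition average_scale : R :=
  (n%:R * (k - l)%:R) / ('C(n, l)%:R * (n - l)%:R * k%:R).

Definition link_average (e : {set V}) : R :=
  average_scale * \sum_(L : {set V} | (#|L| == l) && (L \subset e)) y L (trace L e).

Let n0 : (n%:R : R) != 0. Proof. by rewrite pnatr_eq0 -lt0n (leq_ltn_trans _ lV). Qed.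
Let k0 : (k%:R : R) != 0. Proof. by rewrite pnatr_eq0 -lt0n (leq_ltn_trans _ lk). Qed.
Let kl0 : ((k - l)%:R : R) != 0. Proof. by rewrite pnatr_eq0 -lt0n subn_gt0. Qed.
Let nl0 : ((n - l)%:R : R) != 0. Proof. by rewrite pnatr_eq0 -lt0n subn_gt0. Qed.
Let N0 : ('C(n, l)%:R : R) != 0. Proof. by rewrite pnatr_eq0 -lt0n bin_gt0 ltnW. Qed.

Lemma average_scale_gt0 : 0 < average_scale.
Proof. by rewrite divr_gt0 // !mulr_gt0 // lt0r ler0n andbT. Qed.

Lemma link_weight_ge0 (L e : {set V}) :
  e \in E -> (#|L| == l) && (L \subset e) -> 0 <= y L (trace L e).
Proof.
move=> eE /andP[/eqP Ll Le]; have [y01 _] := yP Ll.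
have /y01/andP[//] : trace L e \in link L E.
by apply: imset_f; rewrite inE eE.
Qed.

Lemma link_average_ge0 (e : {set V}) : e \in E -> 0 <= link_average e.
Proof.
move=> eE; apply: mulr_ge0; first exact/ltW/average_scale_gt0.
by apply: sumr_ge0 => L; apply: link_weight_ge0.
Qed.

Lemma sum_link_total (L : {set V}) : #|L| = l ->
  \sum_(e in E | L \subset e) y L (trace L e) = (n - l)%:R / (k - l)%:R.
Proof.
move=> Ll; rewrite -(sum_link E (y L)).
have := fractional_perfect_matching_total (uniform_link (L := L) uE) (yP Ll).
by rewrite card_outside Ll => <-; rewrite mulrC mulKf.
Qed.

Lemma sum_link_vertex (L : {set V}) (v : V) : #|L| = l ->
  \sum_(e in E | (L \subset e) && (v \in e)) y L (trace L e) =
  if v \in L then (n - l)%:R / (k - l)%:R else 1.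
Proof.
move=> Ll; case: ifPn => vL.
  rewrite -(sum_link_total Ll); apply: eq_bigl => e.
  by case: (boolP (L \subset e)) => //= /fintype.subsetP/(_ v vL) ->.
have [_ /(_ (exist _ v vL)) <-] := yP Ll.
rewrite [RHS]big_mkcondr [RHS]sum_link -big_mkcondr /=.
by apply: eq_bigl => e; rewrite inE andbA.
Qed.

(** A vertex [v] receives [1] from each of the [C(n - 1, l)] links avoiding it
    and the full weight [(n - l) / (k - l)] of every other link; this is
    independent of [v], so a global rescaling makes all vertex sums [1]. *)
Lemma link_average_vertex (v : V) : \sum_(e in E | v \in e) link_average e = 1.
Proof.
rewrite -mulr_sumr (exchange_big_dep (fun L : {set V} => #|L| == l)) /=; last first.
  by move=> e L _ /andP[].
under eq_bigr => L /eqP Ll.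
  rewrite (eq_bigl (fun e => (e \in E) && ((L \subset e) && (v \in e)))); last first.
    by move=> e; rewrite Ll eqxx /= -andbA [(v \in e) && _]andbC.
  rewrite (sum_link_vertex v Ll); over.
set a := _ / _.
rewrite (eq_bigr (fun L : {set V} => a + (if v \notin L then 1 - a else 0))); last first.
  by move=> L _; case: ifP; rewrite /= ?addr0 // addrC subrK.
rewrite big_split /= -big_mkcondr /= !sumr_const.
have -> : #|[pred L : {set V} | #|L| == l]| = 'C(n, l).
  by rewrite -card_draws -[RHS]cardsE; apply: eq_card => L; rewrite !inE.
have -> : #|[pred L : {set V} | (#|L| == l) && (v \notin L)]| = 'C(n.-1, l).
  by rewrite -(card_draws_avoiding v) cardsE.
rewrite -[a *+ _]mulr_natr -[(1 - a) *+ _]mulr_natr.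
have q : 'C(n.-1, l)%:R = (n - l)%:R * 'C(n, l)%:R / n%:R :> R.
  by rewrite -natrM -mul_bin_down natrM mulrC mulKf.
rewrite q /average_scale /a; move: n0 k0 kl0 nl0 N0.
rewrite !natrB ?(ltnW lk) ?(ltnW lV) // => ? ? ? ? ?.
by field; do ?[apply/andP; split].
Qed.

Lemma link_average_fractional_perfect_matching :
  fractional_perfect_matching E link_average.
Proof.
split=> [e eE|v]; last exact: link_average_vertex.
rewrite link_average_ge0 //=.
have /card_gt0P[v ve] : (0 < #|e|)%N by rewrite uE // (leq_ltn_trans _ lk).
rewrite -(link_average_vertex v) (bigD1 e) ?eE //= lerDl sumr_ge0 // => f.
by case/andP=> /andP[fE _] _; exact: link_average_ge0.
Qed.

(** Draw an [l]-set [L] uniformly and then an edge of its link with probability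
    proportional to [y L]. The entropy of the pair is [ln C(n, l)] plus the average
    link entropy, and the edge of [E] it spans determines the pair up to
    [C(k, l)] choices of [L], so forgetting [L] costs at most [ln C(k, l)].
    Here the bound is written for the unnormalised weights. *)
Lemma link_average_entropy (w : R) :
  (forall L : {set V}, #|L| = l -> w <= weight_entropy (link L E) (y L)) ->
  average_scale * 'C(n, l)%:R * w
    - n%:R / k%:R * ln (average_scale * 'C(k, l)%:R)
  <= weight_entropy E link_average.
Proof.
move=> wy; have c0 := average_scale_gt0; set c := average_scale in c0 *.
have M0 : 0 < 'C(k, l)%:R :> R by rewrite ltr0n bin_gt0 ltnW.
set M := _%:R in M0 *.
pose X (e : {set V}) := \sum_(L : {set V} | (#|L| == l) && (L \subset e)) y L (trace L e).
have total : c * \sum_(e in E) X e = n%:R / k%:R.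
  rewrite mulr_sumr.
  have <- := fractional_perfect_matching_total uE link_average_fractional_perfect_matching.
  by rewrite mulrAC mulfV // mul1r.
(* [log_sum] at a single edge [e], over the [C(k, l)] sets [L] inside [e]. *)
have entropy_edge (e : {set V}) : e \in E -> link_average e * ln (link_average e) <=
    c * (\sum_(L : {set V} | (#|L| == l) && (L \subset e))
           y L (trace L e) * ln (y L (trace L e))) + c * X e * ln (c * M).
  move=> eE; rewrite /link_average -/c -/(X e).
  have X0 : 0 <= X e by apply: sumr_ge0 => L; apply: link_weight_ge0.
  have := log_sum (fun L => @link_weight_ge0 L e eE); rewrite -/(X e).
  have -> : #|[pred L : {set V} | (#|L| == l) && (L \subset e)]| = 'C(k, l).
    rewrite -(uE eE) -cards_draws -[RHS]cardsE.
    by apply: eq_card => L; rewrite !inE andbC.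
  rewrite -/M -(ler_pM2l c0) => h.
  have [X_eq0|X_neq0] := eqVneq (X e) 0.
    by move: h; rewrite X_eq0 !(mulr0, mul0r) !addr0.
  have Xgt0 : 0 < X e by rewrite lt_neqAle eq_sym X_neq0.
  by rewrite (lnM c0 Xgt0) (lnM c0 M0); move: h; rewrite !mulrDr !mulrA; lra.
have sum_w : 'C(n, l)%:R * w <= - \sum_(e in E)
    \sum_(L : {set V} | (#|L| == l) && (L \subset e))
      y L (trace L e) * ln (y L (trace L e)).
  rewrite (exchange_big_dep (fun L : {set V} => #|L| == l)) /=; last first.
    by move=> e L _ /andP[].
  rewrite -card_draws -sumrN cardsE mulr_natl -sumr_const.
  apply: ler_sum => L /eqP Ll; apply: le_trans (wy L Ll) _.
  rewrite /weight_entropy (sum_link E (fun f => y L f * ln (y L f))).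
  by rewrite Ll eqxx.
have := ler_sum (index_enum _) entropy_edge.
rewrite big_split /= -mulr_sumr -mulr_suml -mulr_sumr total.
by move: sum_w; rewrite -(ler_pM2l c0) mulrN mulrA /weight_entropy; lra.
Qed.

End Average.

(** * Comparison of the thresholds *)

(** The density [b] does not change because the minimum degrees of [E] and of its
    links are both measured against [C(n - d, k - d)]. *)
Lemma approx_counting_link (R : realType) (l d k : nat) (b : R) :
  0 < b -> (l <= d < k)%N -> approx_counting (d - l) (k - l) b ->
  approx_counting d k b.
Proof.
move=> b0 /andP[ld dk] bP gamma eps g0 e0 e1.
have e20 : 0 < eps / 2 by lra.
have e21 : eps / 2 < 1 by lra.
have [n1 n1P] := bP gamma (eps / 2) g0 e20 e21.
exists (n1 + k)%N => n n1n V E Vn uE dE.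
have lk := leq_ltn_trans ld dk.
have kn := leq_trans (leq_addl n1 k) n1n.
have l_lt_n := leq_trans lk kn.
have dn := ltnW (leq_trans dk kn).
have n1nl : (n1 <= n - l)%N.
  by rewrite leq_subRL ?(ltnW l_lt_n) // addnC (leq_trans _ n1n) // leq_add2l ltnW.
have lV : (l < #|V|)%N by rewrite Vn.
pose delta := (min_degree d E)%:R : R.
have delta0 : 0 < delta.
  by apply: lt_le_trans dE; rewrite mulr_gt0 ?addr_gt0 // ltr0n bin_gt0 leq_sub2r.
pose w : R := (n - l)%:R / (k - l)%:R *
  ln ((1 - eps) * ((k - l)%:R / (n - l)%:R) *
      ('C(n - l, d - l)%:R / 'C(k - l, d - l)%:R) * delta).
have n0 : 0 < n%:R :> R by rewrite ltr0n (leq_ltn_trans _ l_lt_n).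
have k0 : 0 < k%:R :> R by rewrite ltr0n (leq_ltn_trans _ lk).
have nl0 : 0 < (n - l)%:R :> R by rewrite ltr0n subn_gt0.
have kl0 : 0 < (k - l)%:R :> R by rewrite ltr0n subn_gt0.
have Cn0 : 0 < 'C(n - l, d - l)%:R :> R by rewrite ltr0n bin_gt0 leq_sub2r.
have Ck0 : 0 < 'C(k - l, d - l)%:R :> R by rewrite ltr0n bin_gt0 leq_sub2r // ltnW.
have eps0 : 0 < 1 - eps by lra.
have eps20 : 0 < 1 - eps / 2 by lra.
(* The links are used with [eps / 2]: the bound [w] is then strictly below the
   supremum of the entropies, so that some matching reaches it even if the
   supremum is not attained. *)
have linkP (L : {set V}) : exists y : {set outside L} -> R, #|L| = l ->
    fractional_perfect_matching (link L E) y /\ w <= weight_entropy (link L E) y.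
  have [Ll|Ll] := pselect (#|L| = l); last by exists (fun=> 0).
  have oL : #|outside L| = (n - l)%N by rewrite card_outside Vn Ll.
  have md : (min_degree d E <= min_degree (d - l) (link L E))%N.
    by rewrite -Ll; apply: min_degree_link; rewrite Ll ld Vn.
  have uL : uniform (k - l) (link L E) by rewrite -Ll; exact: uniform_link.
  have := n1P _ n1nl _ _ oL uL; rewrite !subnBA // !subnK ?(ltnW l_lt_n) ?(ltnW lk) //.
  have lb : (b + gamma) * 'C(n - d, k - d)%:R <= (min_degree (d - l) (link L E))%:R.
    by apply: (le_trans dE); rewrite ler_nat.
  move=> /(_ lb) sup_ge.
  have w_lt : (w%:E < hypergraph_entropy R (link L E))%E.
    apply: lt_le_trans sup_ge.
    have md0 : 0 < (min_degree (d - l) (link L E))%:R :> R.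
      by apply: (lt_le_trans delta0); rewrite ler_nat.
    rewrite lte_fin ltr_pM2l ?divr_gt0 // ltr_ln ?posrE ?mulr_gt0 ?invr_gt0 //.
    apply: (@lt_le_trans _ _ ((1 - eps / 2) * ((k - l)%:R / (n - l)%:R) *
      ('C(n - l, d - l)%:R / 'C(k - l, d - l)%:R) * delta)).
      by rewrite !ltr_pM2r ?divr_gt0 //; lra.
    by rewrite ler_pM2l ?mulr_gt0 ?invr_gt0 // ler_nat.
  have [_ [y yP <-]] := ereal_sup_gt w_lt.
  by rewrite lte_fin => /ltW wy; exists y.
pose y (L : {set V}) := sval (cid (linkP L)).
have yP (L : {set V}) : #|L| = l -> fractional_perfect_matching (link L E) (y L) /\
  w <= weight_entropy (link L E) (y L) := svalP (cid (linkP L)).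
have yfpm L Ll := (yP L Ll).1; have yw L Ll := (yP L Ll).2.
apply: le_trans (ereal_sup_ubound _); last first.
  by exists (link_average k l y) => //; exact: link_average_fractional_perfect_matching.
rewrite lee_fin; apply: le_trans (link_average_entropy uE lk lV yfpm yw).
have N0 : 0 < 'C(n, l)%:R :> R by rewrite ltr0n bin_gt0 // ltnW.
have M0 : 0 < 'C(k, l)%:R :> R by rewrite ltr0n bin_gt0 // ltnW.
have Nd0 : 0 < 'C(n, d)%:R :> R by rewrite ltr0n bin_gt0 // ltnW.
have Kd0 : 0 < 'C(k, d)%:R :> R by rewrite ltr0n bin_gt0 // ltnW.
have D0 : 0 < 'C(d, l)%:R :> R by rewrite ltr0n bin_gt0.
have scale0 : 0 < average_scale R V k l by apply: average_scale_gt0.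
have scaleE : average_scale R V k l * 'C(n, l)%:R * ((n - l)%:R / (k - l)%:R) =
    n%:R / k%:R.
  rewrite /average_scale Vn; field.
  by rewrite !lt0r_neq0.
rewrite Vn /w [_ * _ * (_ * ln _)]mulrA scaleE -mulrBr ler_pM2l ?divr_gt0 //.
rewrite -ln_div ?posrE; last first.
- by rewrite mulr_gt0.
- by rewrite !mulr_gt0 ?invr_gt0.
rewrite le_eqVlt; apply/orP; left; apply/eqP; congr ln; rewrite -/delta.
have binn : 'C(n - l, d - l)%:R = 'C(n, d)%:R * 'C(d, l)%:R / 'C(n, l)%:R :> R.
  rewrite -natrM -mul_bin_bin ?ld ?dn ?(ltnW dk) // natrM.
  by field; rewrite lt0r_neq0.
have bink : 'C(k - l, d - l)%:R = 'C(k, d)%:R * 'C(d, l)%:R / 'C(k, l)%:R :> R.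
  rewrite -natrM -mul_bin_bin ?ld ?dn ?(ltnW dk) // natrM.
  by field; rewrite lt0r_neq0.
rewrite binn bink /average_scale Vn; field.
by rewrite !lt0r_neq0.
Qed.

(** A [d]-set lies in at most [C(n - d, k - d)] edges, so above density [1] the
    degree hypothesis is never satisfied. *)
Lemma approx_counting1 (R : realType) (d k : nat) :
  (d <= k)%N -> approx_counting d k (1 : R).
Proof.
move=> dk gamma eps g0 _ _; exists k => n kn V E Vn uE; rewrite leNgt => /negP[].
have [A Ad] : exists A : {set V}, #|A| = d by apply: exists_set_card; lia.
have C0 : 0 < 'C(n - d, k - d)%:R :> R by rewrite ltr0n bin_gt0; lia.
apply: (@le_lt_trans _ _ 'C(n - d, k - d)%:R); last by rewrite ltr_pMl //; lra.
rewrite ler_nat -Ad -Vn; apply: leq_trans (min_degree_le E A) _.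
exact: degree_le_bin.
Qed.

Theorem theorem4p2 (R : realType) (l d k : nat)
    (hl : (1 <= l)%N) (hld : (l < d)%N) (hdk : (d <= k - 1)%N) :
  approx_counting_threshold R d k <= approx_counting_threshold R (d - l) (k - l).
Proof.
apply: lb_le_inf.
  by exists 1; split=> //; apply: approx_counting1; lia.
move=> b [b0 bP]; apply: ge_inf; first by exists 0 => x [/ltW].
by split=> //; apply: (approx_counting_link b0 _ bP); lia.
Qed.
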